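(* Let $A$ be a ring and let $\zeta(A)=\zeta(A,\sim_A)$. The following are equivalent: 1. $\zeta(A)$ is finite; 2. $A$ has finitely many ideals; 3. $A\simeq A_1\times A_2$, where $A_1$ is an artinian principal ideal ring and $A_2$ is a finite ring.
   Context: All rings are commutative and unitary; the zero ring is allowed. For $a,b\in A$, $a\sim_A b$ iff $(a)=(b)$ as ideals. $\zeta(A,\sim_A)$ is the graph (loops allowed) with vertex set $A/\!\sim_A$ in which $[a],[b]$ are adjacent iff $ab=0$ (well defined); it is finite if its vertex set is finite. A principal ideal ring (PIR) is a ring in which every ideal is principal. *)

(* Defs.v *)
From mathcomp Require Import all_boot all_algebra.
From mathcomp Require Import boolp classical_sets functions cardinality.

Set Implicit Arguments.
Unset Strict Implicit.
Unset Printing Implicit Defensive.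

Import GRing.Theory.
Local Open Scope ring_scope.
Local Open Scope classical_set_scope.
Local Open Scope quotient_scope.

(* Rings are comPzRingType: commutative and unitary, with the zero ring
   allowed.  The ideals of MathComp's ring_quotient are proper, decidable and
   live in nonzero rings, whence the definition below. *)
Definition ideal (A : comPzRingType) (I : set A) : Prop :=
  [/\ I 0,
      forall x y, I x -> I y -> I (x + y)
    & forall r x, I x -> I (r * x)].

Definition ideals (A : comPzRingType) : set (set A) := [set I | ideal I].
Arguments ideals : clear implicits.

Definition principal_ideal (A : comPzRingType) (a : A) : set A :=
  [set r * a | r in [set: A]].

Lemma ideal_principal (A : comPzRingType) (a : A) : ideal (principal_ideal a).
Proof.
split; first by exists 0; rewrite ?mul0r.
  by move=> _ _ [r _ <-] [s _ <-]; exists (r + s); rewrite ?mulrDl.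
by move=> r _ [s _ <-]; exists (r * s); rewrite ?mulrA.
Qed.

Definition principal_ideal_ring (A : comPzRingType) : Prop :=
  forall I : set A, ideal I -> exists a : A, I = principal_ideal a.

Definition artinian (A : comPzRingType) : Prop :=
  forall I : nat -> set A, (forall n, ideal (I n)) ->
    (forall n, I n.+1 `<=` I n) ->
    exists n, forall m, (n <= m)%N -> I m = I n.

Definition ring_isomorphic (A B : comPzRingType) : Prop :=
  exists f : {rmorphism A -> B}, bijective f.

(* Undirected graphs, loops allowed. *)
Record graph := Graph {
  vertex :> Type;
  adjacent : vertex -> vertex -> Prop;
  adjacent_sym : forall u v, adjacent u v -> adjacent v u
}.

Definition finite_graph (G : graph) : Prop := finite_set [set: vertex G].

(* [assoc a b] is the relation a ~_A b, made boolean by excluded middle so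
   that it can be used with generic_quotient. *)
Definition assoc (A : comPzRingType) (a b : A) : bool :=
  `[< principal_ideal a = principal_ideal b >].

Section AssocEquiv.
Variable A : comPzRingType.

Lemma assoc_refl : reflexive (@assoc A).
Proof. by move=> a; apply/asboolP. Qed.

Lemma assoc_sym : symmetric (@assoc A).
Proof. by move=> a b; apply/asboolP/asboolP. Qed.

Lemma assoc_trans : transitive (@assoc A).
Proof. by move=> b a c /asboolP ab /asboolP bc; apply/asboolP; rewrite ab. Qed.

Canonical assoc_equiv := EquivRel (@assoc A) assoc_refl assoc_sym assoc_trans.
End AssocEquiv.

Definition assoc_class (A : comPzRingType) := {eq_quot (@assoc A)}.

Definition zeta_adj (A : comPzRingType) (u v : assoc_class A) : Prop :=
  repr u * repr v = 0.

Lemma zeta_adj_sym (A : comPzRingType) (u v : assoc_class A) :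
  zeta_adj u v -> zeta_adj v u.
Proof. by rewrite /zeta_adj mulrC. Qed.

Definition zeta (A : comPzRingType) : graph := Graph (@zeta_adj_sym A).

(* The choice of representatives in [zeta_adj] is immaterial. *)
Lemma zeta_adjE (A : comPzRingType) (a b : A) :
  zeta_adj (\pi_(assoc_class A) a) (\pi_(assoc_class A) b) <-> a * b = 0.
Proof.
have reprE c : principal_ideal (repr (\pi_(assoc_class A) c)) = principal_ideal c.
  by apply/asboolP; have /eqmodP := reprK (\pi_(assoc_class A) c).
have mulE (x y : A) : principal_ideal x = principal_ideal y ->
    exists r, x = r * y.
  move=> xy; have : principal_ideal y x by rewrite -xy; exists 1; rewrite ?mul1r.
  by case=> r _ <-; exists r.
have mul0E (x y x' y' : A) : principal_ideal x' = principal_ideal x ->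
    principal_ideal y' = principal_ideal y -> x * y = 0 -> x' * y' = 0.
  by move=> /mulE[r ->] /mulE[s ->] xy0; rewrite mulrACA xy0 mulr0.
by split; apply: mul0E; rewrite reprE.
Qed.

(* Main.v *)
Require Import Defs.
From HB Require Import structures.
From mathcomp Require Import all_boot all_algebra.
From mathcomp Require Import boolp classical_sets functions cardinality.
From mathcomp Require Import ring.

Set Implicit Arguments.
Unset Strict Implicit.
Unset Printing Implicit Defensive.

Import GRing.Theory.
Local Open Scope ring_scope.
Local Open Scope classical_set_scope.

(** The implication from finitely many principal ideals to finitely many
    ideals holds because an ideal is a union of classes of associate elements;
    the converse is immediate, so that the graph [zeta A] is finite exactly
    when [A] has finitely many ideals ([finite_zeta_ideals],
    [finite_ideals_zeta]).

    Let [A] have finitely many ideals; in particular [A] is artinian.  Every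
    idempotent [e] splits off a finite part: [e] is the sum of two orthogonal
    idempotents [f] and [e - f] such that [fA] is finite and every ideal of [A]
    inside [(e - f)A] is principal ([idempotent_splits]).  Such splittings add
    up over orthogonal idempotents, so a counterexample [e] for which [eA] is
    minimal cannot be decomposed; then [eA] is local, each of its elements
    being nilpotent or a unit of [eA] ([primitive_nil_or_unit]).  For [a] in
    [A] and [b] in [eA], consider the ideals [(a + r b)] for varying [r].  If
    two of them, for [r] and [s] in [eA], are equal while [r - s] is a unit of
    [eA], then this ideal contains [b], hence also [a]: the ideal generated by
    [a] and [b] is principal.  Otherwise [r] is determined, up to a nilpotent,
    by one of finitely many ideals, and this forces [eA] to be finite
    ([local_finite_or_bezout]).  So a local [eA] is finite or has only
    principal ideals, and is no counterexample.  For [e = 1] the corner rings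
    of [1 - f] and [f] are the two factors of [A].

    Conversely, let [A] be an artinian principal ideal ring with infinitely
    many ideals, and let [J = (a)] be minimal among the ideals that contain
    infinitely many ideals ([artinian_pir_finite_ideals]).  If [J = N1 + N2]
    with [N1] and [N2] proper, then an ideal [K] inside [J] is the sum of its
    intersections with [N1] and [N2], which leaves finitely many choices.  If
    there is no such decomposition, then the non-generators of [J] form an
    ideal, which contains all ideals strictly inside [J] and has only finitely
    many of them by minimality.  Both cases are absurd.  Finiteness of the set
    of ideals then passes to products and along isomorphisms. *)

(** * Finite sets *)

Lemma finite_powerset (T : eqType) :
  finite_set [set: T] -> finite_set [set: set T].
Proof.
move=> /finite_seqP[s sE].
pose f (m : (size s).-tuple bool) : set T := [set` mask m s].
apply: (@sub_finite_set _ _ (f @` [set: (size s).-tuple bool])); last first.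
  exact: finite_image.
move=> X _; exists [tuple of map (fun x => `[< X x >]) (in_tuple s)] => //.
apply/seteqP; rewrite /f /= -filter_mask; split=> x /=.
  by rewrite mem_filter => /andP[/asboolP].
move=> Xx; rewrite mem_filter; apply/andP; split; first exact/asboolP.
by have : [set: T] x by []; rewrite sE.
Qed.

(** Stated for an arbitrary transitive relation so that it yields minimal as
    well as maximal elements. *)
Lemma finite_minimal (T : eqType) (R : T -> T -> Prop) (C : set T) :
    (forall y x z, R x y -> R y z -> R x z) -> finite_set C -> C !=set0 ->
  exists2 m, C m & forall x, C x -> R x m -> R m x.
Proof.
move=> Rtr /finite_seqP[s ->]; elim: s => [[x]//|a s IHs _].
have [s0|/set0P s0] := eqVneq [set` s] set0.
  exists a => [|x /=]; first by rewrite /= mem_head.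
  rewrite in_cons => /orP[/eqP->//|xs].
  by have : [set` s] x by []; rewrite s0.
have [m ms mP] := IHs s0.
have [Ram|nRam] := pselect (R a m).
- exists a => [|x /=]; first by rewrite /= mem_head.
  rewrite in_cons => /orP[/eqP->//|xs Rxa].
  exact: Rtr Ram (mP x xs (Rtr _ _ _ Rxa Ram)).
exists m => [|x /=]; first by rewrite /= in_cons ms orbT.
by rewrite in_cons => /orP[/eqP->//|xs]; apply: mP.
Qed.

(** * Chain conditions on ideals *)

Section Ideals.
Variable A : comPzRingType.
Implicit Types (a b c e f g h r s x y : A) (I J K : set A).

Lemma principal_ideal_id a : principal_ideal a a.
Proof. by exists 1; rewrite ?mul1r. Qed.

Lemma principal_ideal_sub I a :
  ideal I -> (principal_ideal a `<=` I) <-> I a.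
Proof.
case=> _ _ IM; split=> [|Ia _ [r _ <-]]; last exact: IM.
by apply; exact: principal_ideal_id.
Qed.

Lemma principal_ideal_le a b :
  principal_ideal a b -> principal_ideal b `<=` principal_ideal a.
Proof.
by move=> ab; apply/principal_ideal_sub => //; apply: ideal_principal.
Qed.

Lemma finite_principal0 : finite_set (principal_ideal (0 : A)).
Proof.
apply: (@sub_finite_set _ _ [set 0]); last exact: finite_set1.
by move=> _ [r _ <-]; rewrite mulr0.
Qed.

Lemma in_principal_idem e x : e * e = e -> principal_ideal e x <-> e * x = x.
Proof.
move=> ee; split=> [[r _ <-]|<-]; first by rewrite mulrCA ee.
by exists x => //; rewrite mulrC.
Qed.

Lemma finite_minimal_ideal (C : set (set A)) :
    finite_set (ideals A) -> C `<=` ideals A -> C !=set0 ->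
  exists2 J, C J & forall K, C K -> K `<=` J -> J `<=` K.
Proof.
move=> fA CA C0; have fC := sub_finite_set CA fA.
have Rtr (J I K : set A) : I `<=` J -> J `<=` K -> I `<=` K.
  exact: subset_trans.
exact: (@finite_minimal _ _ C Rtr fC C0).
Qed.

(** A descending chain stabilizes where its range attains a minimal ideal. *)
Lemma finite_ideals_artinian : finite_set (ideals A) -> artinian A.
Proof.
move=> fA I Iid Idec.
have [||_ [n _ <-] nmin] := @finite_minimal_ideal (range I) fA.
- by move=> _ [n _ <-]; exact: Iid.
- by exists (I 0%N), 0%N.
have Imono m k : (m <= k)%N -> I k `<=` I m.
  elim: k => [|k IHk]; first by rewrite leqn0 => /eqP->.
  rewrite leq_eqVlt => /orP[/eqP->//|]; rewrite ltnS => /IHk.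
  exact: subset_trans (Idec k).
exists n => m /Imono mn; apply/seteqP; split=> //.
by apply: nmin => //; exists m.
Qed.

(** Without a minimal element, choosing a strictly smaller ideal over and over
    gives a descending chain that never stabilizes. *)
Lemma artinian_minimal (C : set (set A)) :
    artinian A -> C `<=` ideals A -> C !=set0 ->
  exists2 J, C J & forall K, C K -> K `<=` J -> J `<=` K.
Proof.
move=> artA CA [I0 CI0]; apply: contrapT => nmin.
have step J : exists K, C J -> [/\ C K, K `<=` J & ~ J `<=` K].
  have [CJ|] := pselect (C J); last by exists J.
  apply: contrapT => nK; apply: nmin; exists J => // K CK KJ.
  by apply: contrapT => JK; apply: nK; exists K.
have [next nextP] := choice step.
have Citer n : C (iter n next I0).
  by elim: n => // n /nextP[].
have [||n nP] := artA (fun n => iter n next I0).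
- by move=> n; apply: CA.
- by move=> n; case: (nextP _ (Citer n)).
have [_ _] := nextP _ (Citer n); apply.
by have /= -> := nP _ (leqnSn n).
Qed.

End Ideals.

(** * Finiteness of the graph and of the set of ideals *)

Lemma finite_ideals_zeta (A : comPzRingType) :
  finite_set (ideals A) -> finite_graph (zeta A).
Proof.
move=> fA; pose f (u : assoc_class A) := principal_ideal (repr u).
rewrite /finite_graph; suff -> : [set: vertex (zeta A)] = f @^-1` ideals A.
  apply: finite_preimage => // u v _ _ /= /asboolP uv.
  by rewrite -[u]reprK -[v]reprK; apply/eqmodP.
by apply/seteqP; split=> // u _; apply: ideal_principal.
Qed.

(** Associate elements lie in the same ideals, so an ideal is the union of the
    classes that it meets, and there are finitely many sets of classes. *)
Lemma finite_zeta_ideals (A : comPzRingType) :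
  finite_graph (zeta A) -> finite_set (ideals A).
Proof.
move=> /finite_powerset fV.
pose union (S : set (assoc_class A)) : set A :=
  [set x | S (\pi_(assoc_class A)%qT x)].
apply: (@sub_finite_set _ _ (range union)); last exact: finite_image.
move=> I Iid; exists [set u | I (repr u)] => //.
apply/seteqP; rewrite /union; split=> x /=;
  have /asboolP xE : assoc (repr (\pi_(assoc_class A)%qT x)) x
    by have /eqmodP := reprK (\pi_(assoc_class A)%qT x).
- move=> /principal_ideal_sub => /(_ Iid); rewrite xE.
  by move/principal_ideal_sub; apply.
- move=> /principal_ideal_sub => /(_ Iid); rewrite -xE.
  by move/principal_ideal_sub; apply.
Qed.

(** * Products of an artinian principal ideal ring and a finite ring *)

(** A generator [a] of an ideal [J] that is minimal among those containing
    infinitely many ideals plays the role of 1 in a local-or-decomposable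
    alternative: either [a] is a sum of two elements of proper subideals, and
    multiplying by the two terms splits every subideal of [J], or the
    non-generators of [J] are closed under addition. *)
Lemma artinian_pir_finite_ideals (A : comPzRingType) :
  artinian A -> principal_ideal_ring A -> finite_set (ideals A).
Proof.
move=> artA pirA; apply: contrapT => infA.
pose below (J : set A) := [set K | ideal K /\ K `<=` J].
have [||J [Jid infJ] Jmin] := @artinian_minimal A
    [set J | ideal J /\ infinite_set (below J)] artA.
- by move=> J [].
- exists setT; split=> //; apply: contra_not infA; apply: sub_finite_set.
  by move=> I Iid; split.
have [a JE] := pirA _ Jid.
have Ja : J a by rewrite JE; apply: principal_ideal_id.
have JP (K : set A) : ideal K -> K a -> J `<=` K.
  by rewrite JE => Kid Ka; apply/principal_ideal_sub.
have fin N : ideal N -> N `<=` J -> ~ N a -> finite_set (below N).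
  move=> Nid NJ Na; apply: contrapT => infN.
  by apply: Na; apply: (Jmin N) => //; split.
have [[N1 [N2 [[N1id N1J N1a] [N2id N2J N2a] [x N1x [y N2y aE]]]]]|hollow] :=
    pselect (exists N1 N2 : set A, [/\ [/\ ideal N1, N1 `<=` J & ~ N1 a],
      [/\ ideal N2, N2 `<=` J & ~ N2 a]
    & exists2 x, N1 x & exists2 y, N2 y & a = x + y]).
  pose sum (K1 K2 : set A) := [set u + v | u in K1 & v in K2].
  apply: infJ; apply: (@sub_finite_set _ _
    [set sum K1 K2 | K1 in below N1 & K2 in below N2]); last first.
    by apply: finite_image2; apply: fin.
  (* A multiple s a of a is s x + s y, and both terms stay in K since x and y
     are themselves multiples of a. *)
  move=> K [[K0 KD KM] KJ].
  have capP (N : set A) : ideal N -> below N (K `&` N).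
    move=> [N0 ND NM]; split; last by move=> ? [].
    split; first by split.
    - by move=> u v [Ku Nu] [Kv Nv]; split; [apply: KD|apply: ND].
    - by move=> r u [Ku Nu]; split; [apply: KM|apply: NM].
  exists (K `&` N1); first exact: capP.
  exists (K `&` N2); first exact: capP.
  apply/seteqP; split=> [_ [u [Ku _]] [v [Kv _]] <-|k Kk]; first exact: KD.
  have mulJ s z : J z -> K (s * a) -> K (s * z).
    rewrite JE => -[t _ <-]; rewrite mulrCA; exact: KM.
  have [s _ sE] : principal_ideal a k by rewrite -JE; apply: KJ.
  rewrite -sE in Kk *.
  have N1s : N1 (s * x) by case: N1id => _ _; apply.
  have N2s : N2 (s * y) by case: N2id => _ _; apply.
  exists (s * x); first by split=> //; apply: mulJ => //; apply: N1J.
  exists (s * y); first by split=> //; apply: mulJ => //; apply: N2J.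
  by rewrite aE mulrDr.
(* When J is the zero ideal, its set N of non-generators is empty, hence not an
   ideal. *)
have [a0|a_neq0] := eqVneq a 0.
  apply: infJ; apply: (@sub_finite_set _ _ [set J]); last exact: finite_set1.
  move=> K [Kid KJ]; apply/seteqP; split=> //; apply: JP => //.
  by rewrite a0; case: Kid.
pose N := [set x | J x /\ ~ principal_ideal x a].
have Nid : ideal N.
  case: (Jid) => J0 JD JM; split.
  - by split=> // -[r _]; rewrite mulr0 => a0; rewrite -a0 eqxx in a_neq0.
  - move=> x y [Jx xa] [Jy ya]; split; first exact: JD.
    move=> [r _ aE]; apply: hollow.
    exists (principal_ideal x), (principal_ideal y).
    split.
    + by split=> //; [apply: ideal_principal|apply/principal_ideal_sub].
    + by split=> //; [apply: ideal_principal|apply/principal_ideal_sub].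
    by exists (r * x); [exists r|exists (r * y); [exists r|rewrite -mulrDr]].
  - move=> r x [Jx xa]; split; first exact: JM.
    by apply: contra_not xa; apply: principal_ideal_le; exists r.
apply: infJ; apply: (@sub_finite_set _ _ ([set J] `|` below N)); last first.
  rewrite finite_setU; split; first exact: finite_set1.
  by apply: fin => // [x []|[_]]; last by apply; apply: principal_ideal_id.
move=> K [Kid KJ]; have [Ka|Ka] := pselect (K a).
  by left; apply/seteqP; split=> //; apply: JP.
right; split=> // k Kk; split; first exact: KJ.
by apply: contra_not Ka => ka; case: (principal_ideal_sub k Kid) => _; exact.
Qed.

(** Multiplying by (1, 0) and (0, 1) shows that an ideal of the product is the
    product of its two slices through 0. *)
Lemma finite_ideals_prod (A B : comPzRingType) :
  finite_set (ideals A) -> finite_set (ideals B) ->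
  finite_set (ideals (A * B)%type).
Proof.
move=> fA fB; pose f (I : set A) (J : set B) := I `*` J.
apply: (@sub_finite_set _ _ [set f I J | I in ideals A & J in ideals B]);
  last exact: finite_image2.
move=> K [K0 KD KM].
exists [set x | K (x, 0)].
  split=> //= [x y Kx Ky|r x Kx].
    by have := KD _ _ Kx Ky; rewrite /GRing.add /= /add_pair /= addr0.
  by have := KM (r, 0) _ Kx; rewrite /GRing.mul /= /mul_pair /= mulr0.
exists [set y | K (0, y)].
  split=> //= [x y Kx Ky|r x Kx].
    by have := KD _ _ Kx Ky; rewrite /GRing.add /= /add_pair /= addr0.
  by have := KM (0, r) _ Kx; rewrite /GRing.mul /= /mul_pair /= mulr0.
apply/seteqP; split=> [[x y] [/= Kx Ky]|[x y] Kxy].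
  by have := KD _ _ Kx Ky; rewrite /GRing.add /= /add_pair /= addr0 add0r.
split=> /=.
  by have := KM (1, 0) _ Kxy; rewrite /GRing.mul /= /mul_pair /= mul1r mul0r.
by have := KM (0, 1) _ Kxy; rewrite /GRing.mul /= /mul_pair /= mul1r mul0r.
Qed.

Lemma finite_ideals_iso (A B : comPzRingType) :
  ring_isomorphic A B -> finite_set (ideals B) -> finite_set (ideals A).
Proof.
move=> [f fbij] /(finite_image (fun J => f @^-1` J)); apply: sub_finite_set.
have finj := bij_inj fbij; case: fbij => g fK gK I [I0 ID IM].
exists (f @` I); last first.
  apply/seteqP; split=> [x [y Iy /finj <-//]|x Ix].
  by exists x.
split; first by exists 0; rewrite ?rmorph0.
  move=> _ _ [x Ix <-] [y Iy <-].
  by exists (x + y); [apply: ID|rewrite rmorphD].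
move=> r _ [x Ix <-]; exists (g r * x); first exact: IM.
by rewrite rmorphM gK.
Qed.

Lemma finite_ideals_artinian_pir_by_finite (A : comPzRingType) :
    (exists A1 A2 : comPzRingType,
       [/\ artinian A1, principal_ideal_ring A1, finite_set [set: A2]
         & ring_isomorphic A (A1 * A2)%type]) ->
  finite_set (ideals A).
Proof.
move=> [A1 [A2 [art1 pir1 /finite_powerset fin2 iso]]].
apply: finite_ideals_iso iso _; apply: finite_ideals_prod.
  exact: artinian_pir_finite_ideals.
exact: sub_finite_set fin2.
Qed.

(** * Splitting off a finite part by idempotents *)

Section Idempotents.
Variable A : comPzRingType.
Implicit Types (a b c e f g h r s x y : A) (I J K : set A).

(** The powers of [x] generate a descending chain; at the level where it
    stabilizes, the power and its square generate the same ideal. *)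
Lemma artinian_power_regular x :
  artinian A -> exists k s, x ^+ k.+1 = s * x ^+ k.+1 * x ^+ k.+1.
Proof.
move=> artA.
have [n|n|n nP] := artA (fun n => principal_ideal (x ^+ n.+1)).
- exact: ideal_principal.
- by apply: principal_ideal_le; exists x; rewrite -?exprS.
have le_n : (n <= n + n.+1)%N by rewrite leq_addr.
have [s _ sE] : principal_ideal (x ^+ (n + n.+1).+1) (x ^+ n.+1).
  by rewrite (nP _ le_n); apply: principal_ideal_id.
by exists n, s; rewrite -mulrA -exprD addSn sE.
Qed.

(** Unlike in the usual terminology, 0 counts as primitive. *)
Definition primitive e :=
  forall h, h * h = h -> e * h = h -> h = 0 \/ h = e.

(** If some positive power [X] of [x] equals [s X X], then [s X] is an
    idempotent: it is 0 when [x] is nilpotent, and [e] when [x] is a unit of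
    [eA]. *)
Lemma primitive_nil_or_unit e x : artinian A -> primitive e -> e * x = x ->
  (exists k, x ^+ k = 0) \/ (exists y, y * x = e).
Proof.
move=> artA prim_e ex.
have [k [s xkE]] := artinian_power_regular x artA.
have [||h0|he] := prim_e (s * x ^+ k.+1).
- set X := x ^+ _ in xkE *; transitivity (s * (s * X * X)); first by ring.
  by rewrite -xkE.
- by rewrite exprS mulrCA [e * _]mulrA ex.
- by left; exists k.+1; rewrite xkE h0 mul0r.
- by right; exists (s * x ^+ k); rewrite -he exprSr mulrA.
Qed.

(** Suppose that [b] is never in [(a + r b)].  Then equality of [(a + r b)] and
    [(a + s b)] forces [(r - s) e] to be nilpotent, so [eA] modulo nilpotents
    is finite.  To lift this to [eA], take a minimal infinite principal ideal
    [(c)] inside [eA]: the multiples of [c] by nilpotents generate strictly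
    smaller, hence finite, ideals, so there are finitely many of them, and
    [(c)] is covered by finitely many of their translates. *)
Lemma local_finite_or_bezout e : e * e = e -> finite_set (ideals A) ->
    (forall x, e * x = x -> (exists k, x ^+ k = 0) \/ (exists y, y * x = e)) ->
  finite_set (principal_ideal e) \/
  forall a b, e * b = b -> exists r, principal_ideal (a + r * b) b.
Proof.
move=> ee fA nil_unit.
have [?|inf_e] := pselect (finite_set (principal_ideal e)); [by left|right].
move=> a b eb; apply: contrapT => no_r.
pose line r := principal_ideal (a + r * b).
have line_nil r s : line r = line s -> exists k, ((r - s) * e) ^+ k = 0.
  move=> rs; have [|//|[y yE]] := nil_unit ((r - s) * e).
    by rewrite mulrCA ee.
  case: no_r; exists r; rewrite -/(line r).
  have [_ lD lM] := ideal_principal (a + r * b).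
  have ar : line r (a + r * b) by apply: principal_ideal_id.
  have as_ : line r (a + s * b) by rewrite rs; apply: principal_ideal_id.
  have -> : b = y * ((a + r * b) + - 1 * (a + s * b)).
    rewrite -{1}eb -yE -mulrA -mulrA eb; ring.
  by apply: (lM); apply: (lD) => //; apply: lM.
have [||_ [c [[ec inf_c] <-]] cmin] := @finite_minimal_ideal A
   [set principal_ideal c | c in
     [set c | e * c = c /\ infinite_set (principal_ideal c)]] fA.
- by move=> _ [c _ <-]; apply: ideal_principal.
- by exists (principal_ideal e), e.
pose nilmul := [set y | exists x k, [/\ x ^+ k = 0 & y = x * c]].
have fin_nilmul : finite_set nilmul.
  apply: (@sub_finite_set _ _
      (\bigcup_(I in [set principal_ideal y | y in nilmul]) I)).
    move=> y ny; exists (principal_ideal y); first by exists y.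
    exact: principal_ideal_id.
  apply: bigcup_finite.
    by apply: sub_finite_set fA => _ [y _ <-]; apply: ideal_principal.
  move=> _ [_ [x [k [xk0 ->]]] <-]; apply: contrapT => inf_xc.
  have [||s _ sE] :=
      cmin (principal_ideal (x * c)) _ _ c (principal_ideal_id c).
  - by exists (x * c) => //; split=> //; rewrite mulrCA ec.
  - by apply: principal_ideal_le; exists x.
  (* Now c = s x c with x nilpotent, so c = 0. *)
  apply: inf_c; suff -> : c = 0 by apply: finite_principal0.
  have cE m : c = (s * x) ^+ m * c.
    by elim: m => [|m IHm]; rewrite ?mul1r // exprS -mulrA -IHm -mulrA sE.
  by rewrite (cE k) exprMn xk0 mulr0 mul0r.
apply: inf_c.
apply: (@sub_finite_set _ _
  (\bigcup_(P in range line) [set r * c | r in [set r | line r = P]])).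
  by move=> _ [r _ <-]; exists (line r); [exists r|exists r].
apply: bigcup_finite.
  by apply: sub_finite_set fA => _ [r _ <-]; apply: ideal_principal.
move=> _ [s _ <-].
apply: (@sub_finite_set _ _ [set s * c + y | y in nilmul]); last first.
  exact: finite_image.
move=> _ [r rs <-]; have [k kE] := line_nil _ _ rs.
exists ((r - s) * e * c); last by rewrite -mulrA ec; ring.
by exists ((r - s) * e), k.
Qed.

Definition pir_below g :=
  forall I, ideal I -> I `<=` principal_ideal g ->
    exists a, I = principal_ideal a.

(** With finitely many ideals, [I] contains a maximal principal ideal [(a)].
    Enlarging it by any [b] in [I] gives a principal ideal [(a + r b)] again,
    so [b] is in [(a)]. *)
Lemma pir_below_bezout e : finite_set (ideals A) -> e * e = e ->
    (forall a b, e * b = b -> exists r, principal_ideal (a + r * b) b) ->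
  pir_below e.
Proof.
move=> fA ee bez I Iid Ie.
have fC : finite_set [set principal_ideal a | a in I].
  by apply: sub_finite_set fA => _ [a _ <-]; apply: ideal_principal.
have [I0 ID IM] := Iid.
have [||_ [a Ia <-] amax] :=
    @finite_minimal _ (fun J K : set A => K `<=` J) _ _ fC.
- by move=> J K L KJ JL; apply: subset_trans KJ.
- by exists (principal_ideal 0), 0.
exists a; apply/seteqP; split; last exact/principal_ideal_sub.
move=> b Ib; have [|r rb] := bez a b.
  by apply/in_principal_idem => //; apply: Ie.
have ra : principal_ideal (a + r * b) a.
  have [_ lD lM] := ideal_principal (a + r * b).
  have {2}-> : a = (a + r * b) + - r * b by ring.
  by apply: lD; [apply: principal_ideal_id|apply: lM].
apply: amax rb; last exact: principal_ideal_le.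
by exists (a + r * b) => //; apply: ID => //; apply: IM.
Qed.

(** [I] is the sum of its parts [gI] and [hI]; if [a] and [b] generate them,
    then [ga + hb] generates [I], as multiplying it by [g] or [h] isolates
    either term. *)
Lemma pir_belowD g h : g * g = g -> h * h = h -> g * h = 0 ->
  pir_below g -> pir_below h -> pir_below (g + h).
Proof.
move=> gg hh gh pg ph I Iid Igh; have [I0 ID IM] := Iid.
have part k : k * k = k -> pir_below k ->
    exists2 a, I a & forall x, I x -> principal_ideal a (k * x).
  move=> kk pk; have [||a aE] := pk (I `&` principal_ideal k).
  - have [k0 kD kM] := ideal_principal k; split=> //.
    + by move=> x y [Ix kx] [Iy ky]; split; [apply: ID|apply: kD].
    + by move=> r x [Ix kx]; split; [apply: IM|apply: kM].
  - by move=> x [].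
  have [Ia _] : (I `&` principal_ideal k) a.
    by rewrite aE; apply: principal_ideal_id.
  exists a => // x Ix; rewrite -aE; split; first exact: IM.
  by exists x => //; rewrite mulrC.
have [a Ia aP] := part g gg pg; have [b Ib bP] := part h hh ph.
exists (g * a + h * b); apply/seteqP; split; last first.
  by apply/principal_ideal_sub => //; apply: ID; apply: IM.
move=> x Ix; have := Igh x Ix.
move/in_principal_idem => <-; last first.
  by rewrite mulrDl !mulrDr gg hh [h * g]mulrC gh addr0 add0r.
have [r _ rE] := aP x Ix; have [s _ sE] := bP x Ix.
exists (g * r + h * s) => //.
have -> : (g + h) * x = g * (g * x) + h * (h * x).
  by rewrite !mulrA gg hh mulrDl.
rewrite -rE -sE.
transitivity ((g * g) * (r * a) + (h * h) * (s * b)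
  + (g * h) * (r * b + s * a)); first by ring.
by rewrite gg hh gh mul0r addr0.
Qed.

(** The decomposition of [eA] into a finite ring and a principal ideal ring,
    expressed by ideals of [A] so that decompositions below orthogonal
    idempotents can be added without changing the ring. *)
Definition splits e := exists f,
  [/\ f * f = f, e * f = f, finite_set (principal_ideal f) & pir_below (e - f)].

Lemma splitsD g h : g * g = g -> h * h = h -> g * h = 0 ->
  splits g -> splits h -> splits (g + h).
Proof.
move=> gg hh gh [f [ff gf finf pf]] [k [kk hk fink pk]].
have fk : f * k = 0 by rewrite -gf -hk mulrACA gh mul0r.
have gk : g * k = 0 by rewrite -hk mulrA gh mul0r.
have hf : h * f = 0 by rewrite -gf mulrA [h * g]mulrC gh mul0r.
exists (f + k); split.
- by rewrite mulrDl !mulrDr ff kk [k * f]mulrC fk addr0 add0r.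
- by rewrite mulrDl !mulrDr gf hk gk hf addr0 add0r.
- apply: (@sub_finite_set _ _
    [set x + y | x in principal_ideal f & y in principal_ideal k]).
    move=> _ [r _ <-]; exists (r * f); first by exists r.
    by exists (r * k); [exists r|rewrite mulrDr].
  exact: finite_image2.
have -> : g + h - (f + k) = (g - f) + (h - k) by ring.
apply: pir_belowD => //.
- by transitivity (g * g - (g * f) *+ 2 + f * f); [ring|rewrite gg gf ff; ring].
- by transitivity (h * h - (h * k) *+ 2 + k * k); [ring|rewrite hh hk kk; ring].
- transitivity (g * h - g * k - h * f + f * k); first by ring.
  by rewrite gh gk hf fk; ring.
Qed.

(** A minimal counterexample is primitive, as it cannot be a sum of two smaller
    orthogonal idempotents; then it splits trivially, with [f = e] if [eA] is
    finite and [f = 0] otherwise. *)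
Lemma idempotent_splits e : finite_set (ideals A) -> e * e = e -> splits e.
Proof.
move=> fA ee; apply: contrapT => bad_e.
have [||_ [{bad_e}e_ [ee_ bad_e] <-] emin] := @finite_minimal_ideal A
    [set principal_ideal h | h in [set h | h * h = h /\ ~ splits h]] fA.
- by move=> _ [h _ <-]; apply: ideal_principal.
- by exists (principal_ideal e), e.
move: e_ {e ee} ee_ bad_e emin => e ee bad_e emin.
have small h : h * h = h -> e * h = h -> h <> e -> splits h.
  move=> hh eh he; apply: contrapT => bad_h; apply: he.
  have [||r _ rE] := emin (principal_ideal h) _ _ e (principal_ideal_id e).
  - by exists h.
  - by apply/principal_ideal_le/in_principal_idem.
  by rewrite -eh -rE -mulrA hh.
have prim_e : primitive e.
  move=> h hh eh; apply: contrapT => /not_orP[h0 he]; apply: bad_e.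
  have -> : e = h + (e - h) by ring.
  have heh : h * (e - h) = 0 by rewrite mulrBr hh mulrC eh subrr.
  have eheh : (e - h) * (e - h) = e - h.
    by rewrite mulrBl heh mulrBr ee eh subr0.
  apply: splitsD => //; first exact: small.
  apply: small => //; first by rewrite mulrBr ee eh.
  by move=> ehe; apply: h0; rewrite -[h](subKr e) ehe subrr.
have [|fin_e|bez] := local_finite_or_bezout ee fA.
- move=> x; apply: primitive_nil_or_unit => //.
  exact: finite_ideals_artinian.
- apply: bad_e; exists e; split=> //; rewrite subrr => I [I0 _ _] I_0.
  by exists 0; apply/seteqP; split=> // _ [r _ <-]; rewrite mulr0.
- apply: bad_e; exists 0; rewrite subr0; split; rewrite ?mulr0 //.
    exact: finite_principal0.
  exact: pir_below_bezout.
Qed.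

End Idempotents.

(** * Corner rings and the Peirce decomposition *)

Section Corner.
Variables (A : comPzRingType) (e : A) (ee : e * e = e).

Definition corner_pred := [pred x : A | e * x == x].

Fact corner_zmod_closed : zmod_closed corner_pred.
Proof.
split=> [|x y]; rewrite !inE ?mulr0 //.
by move=> /eqP ex /eqP ey; rewrite mulrBr ex ey.
Qed.
HB.instance Definition _ :=
  GRing.isZmodClosed.Build A corner_pred corner_zmod_closed.

(** The ring [eA], with unit [e].  The type takes the proof that [e] is
    idempotent as a parameter because its ring structure depends on it. *)
Definition corner & e * e = e := {x : A | corner_pred x}.
HB.instance Definition _ := SubType.copy (corner ee) {x : A | corner_pred x}.
HB.instance Definition _ := Choice.copy (corner ee) {x : A | corner_pred x}.
HB.instance Definition _ := [SubChoice_isSubZmodule of corner ee by <:].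

Fact corner1_subproof : corner_pred e.
Proof. by rewrite inE /= ee. Qed.
Definition corner1 : corner ee := Sub e corner1_subproof.

Lemma valcP (x : corner ee) : e * val x = val x.
Proof. by apply/eqP; have := valP x. Qed.

Fact corner_mul_subproof (x y : corner ee) : corner_pred (val x * val y).
Proof. by rewrite inE /= mulrA valcP. Qed.
Definition corner_mul (x y : corner ee) : corner ee :=
  Sub (val x * val y) (corner_mul_subproof x y).

Fact corner_mulA : associative corner_mul.
Proof. by move=> x y z; apply: val_inj; apply: mulrA. Qed.
Fact corner_mulC : commutative corner_mul.
Proof. by move=> x y; apply: val_inj; apply: mulrC. Qed.
Fact corner_mul1 : left_id corner1 corner_mul.
Proof. by move=> x; apply: val_inj; apply: valcP. Qed.
Fact corner_mulD : left_distributive corner_mul +%R.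
Proof. by move=> x y z; apply: val_inj; apply: mulrDl. Qed.
HB.instance Definition _ := GRing.Zmodule_isComPzRing.Build (corner ee)
  corner_mulA corner_mulC corner_mul1 corner_mulD.

Fact to_corner_subproof (x : A) : corner_pred (e * x).
Proof. by rewrite inE /= mulrA ee. Qed.
Definition to_corner x : corner ee := Sub (e * x) (to_corner_subproof x).

Fact to_corner_zmod : zmod_morphism to_corner.
Proof. by move=> x y; apply: val_inj; apply: mulrBr. Qed.
Fact to_corner_monoid : monoid_morphism to_corner.
Proof.
split=> [|x y]; apply: val_inj; rewrite /= ?mulr1 //.
by rewrite mulrACA ee.
Qed.
HB.instance Definition _ :=
  GRing.isZmodMorphism.Build A (corner ee) to_corner to_corner_zmod.
HB.instance Definition _ :=
  GRing.isMonoidMorphism.Build A (corner ee) to_corner to_corner_monoid.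

(** Ideals of [eA] are ideals of [A], since [A] acts on [eA] through
    multiplication by [e]; this transports the properties below from [A]. *)
Lemma ideal_corner_val (I : set (corner ee)) : ideal I -> ideal (val @` I).
Proof.
move=> [I0 ID IM]; split; first by exists 0.
  by move=> _ _ [x Ix <-] [y Iy <-]; exists (x + y); [apply: ID|].
move=> r _ [x Ix <-]; exists (to_corner r * x); first exact: IM.
by rewrite /= mulrAC valcP mulrC.
Qed.

Lemma corner_pir : pir_below e -> principal_ideal_ring (corner ee).
Proof.
move=> pe I Iid; have [|a aE] := pe _ (ideal_corner_val Iid).
  by move=> _ [x _ <-]; exists (val x); rewrite // mulrC valcP.
have [c Ic ca] : (val @` I) a by rewrite aE; apply: principal_ideal_id.
exists c; apply/seteqP; split; last by apply/principal_ideal_sub.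
move=> x Ix; have [r _ rE] : principal_ideal a (val x) by rewrite -aE; exists x.
exists (to_corner r) => //; apply: val_inj.
by rewrite /= ca -mulrA rE valcP.
Qed.

Lemma corner_artinian : artinian A -> artinian (corner ee).
Proof.
move=> artA I Iid Idec; have [n|n|n nP] := artA (fun n => val @` I n).
- exact: ideal_corner_val.
- by move=> _ [x Ix <-]; exists x => //; apply: Idec.
exists n => m /nP valI; apply/seteqP; split=> x Ix.
  by have [y Iy /val_inj <-] : (val @` I n) (val x) by rewrite -valI; exists x.
by have [y Iy /val_inj <-] : (val @` I m) (val x) by rewrite valI; exists x.
Qed.

Lemma corner_finite :
  finite_set (principal_ideal e) -> finite_set [set: corner ee].
Proof.
move=> fe; have -> : [set: corner ee] = val @^-1` principal_ideal e.
  by apply/seteqP; split=> // x _; exists (val x); rewrite // mulrC valcP.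
by apply: finite_preimage fe => x y _ _; apply: val_inj.
Qed.
End Corner.

Lemma peirce_decomposition (A : comPzRingType) (g f : A)
    (gg : g * g = g) (ff : f * f = f) :
  g + f = 1 -> ring_isomorphic A (corner gg * corner ff)%type.
Proof.
move=> gf1.
pose phi (x : A) := (to_corner gg x, to_corner ff x).
have phiZ : zmod_morphism phi by move=> x y; rewrite /phi !raddfB.
have phiM : monoid_morphism phi.
  by split=> [|x y]; rewrite /phi ?rmorph1 ?rmorphM.
pose phiZi := GRing.isZmodMorphism.Build _ _ phi phiZ.
pose phiMi := GRing.isMonoidMorphism.Build _ _ phi phiM.
pose phiR : {rmorphism A -> (corner gg * corner ff)%type} :=
  HB.pack phi phiZi phiMi.
have fg : f * g = 0.
  by apply: (addIr (f * f)); rewrite -mulrDr gf1 mulr1 add0r ff.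
exists phiR; exists (fun u => val u.1 + val u.2) => [x|[u v]] /=.
  by rewrite -mulrDl gf1 mul1r.
have gv : g * val v = 0 by rewrite -(valcP v) mulrA [g * f]mulrC fg mul0r.
have fu : f * val u = 0 by rewrite -(valcP u) mulrA fg mul0r.
congr (_, _); apply: val_inj; rewrite /= mulrDr ?gv ?fu valcP ?addr0 ?add0r //.
Qed.

Theorem theorem4p1 (A : comPzRingType) :
  [<-> finite_graph (zeta A);
       finite_set (ideals A);
       exists A1 A2 : comPzRingType,
         [/\ artinian A1, principal_ideal_ring A1,
             finite_set [set: A2]%classic
           & ring_isomorphic A (A1 * A2)%type]].
Proof.
tfae; first exact: finite_zeta_ideals; last first.
  by move=> /finite_ideals_artinian_pir_by_finite/finite_ideals_zeta.
move=> fA; have [f [ff _ fin_f pir_f]] := idempotent_splits fA (mulr1 1).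
have gg : (1 - f) * (1 - f) = 1 - f.
  by rewrite mulrBr mulr1 mulrBl mul1r ff subrr subr0.
exists (corner gg), (corner ff); split.
- exact/corner_artinian/finite_ideals_artinian.
- exact: corner_pir.
- exact: corner_finite.
- by apply: peirce_decomposition; rewrite subrK.
Qed.
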